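(* For two states $L,R$ of the ideal MHD system let $\widehat{\mathcal H}$ be the discrete entropy Jacobian given in the context. Define the averages $$\tilde p=\frac{\{\!\{\rho\}\!\}}{2\{\!\{\beta\}\!\}},\quad \bar a^2=\gamma\frac{\tilde p}{\rho^{\ln}},\quad (a^{\ln})^2=\gamma\frac{p^{\ln}}{\rho^{\ln}},\quad (a^\beta)^2=\gamma\frac1{2\{\!\{\beta\}\!\}},\quad \bar b_k=\frac{\{\!\{B_k\}\!\}}{\sqrt{\rho^{\ln}}}\ (k=1,2,3),$$ $$\bar b^2=\bar b_1^2+\bar b_2^2+\bar b_3^2,\quad \bar b_\perp^2=\bar b_2^2+\bar b_3^2,\quad \bar\beta_k=\frac{\bar b_k}{\bar b_\perp},\quad \hat c_{f,s}^2=\tfrac12\Big((\bar a^2+\bar b^2)\pm\sqrt{(\bar a^2+\bar b^2)^2-4\bar a^2\bar b_1^2}\Big),$$ $$\hat\alpha_f^2=\frac{\bar a^2-\hat c_s^2}{\hat c_f^2-\hat c_s^2},\quad \hat\alpha_s^2=\frac{\hat c_f^2-\bar a^2}{\hat c_f^2-\hat c_s^2},\quad \sigma(\omega)=\begin{cases}+1&\omega\ge0\\-1&\text{otherwise,}\end{cases}$$ $$\hat\Psi_{\pm s}=\tfrac{\hat\alpha_s\rho^{\ln}\overline{\|\vec u\|^2}}2-a^\beta\hat\alpha_f\rho^{\ln}\bar b_\perp+\tfrac{\hat\alpha_s\rho^{\ln}(a^{\ln})^2}{\gamma-1}\pm\hat\alpha_s\hat c_s\rho^{\ln}\{\!\{u\}\!\}\pm\hat\alpha_f\hat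 c_f\rho^{\ln}\sigma(\bar b_1)(\{\!\{v\}\!\}\bar\beta_2+\{\!\{w\}\!\}\bar\beta_3),$$ $$\hat\Psi_{\pm f}=\tfrac{\hat\alpha_f\rho^{\ln}\overline{\|\vec u\|^2}}2+a^\beta\hat\alpha_s\rho^{\ln}\bar b_\perp+\tfrac{\hat\alpha_f\rho^{\ln}(a^{\ln})^2}{\gamma-1}\pm\hat\alpha_f\hat c_f\rho^{\ln}\{\!\{u\}\!\}\mp\hat\alpha_s\hat c_s\rho^{\ln}\sigma(\bar b_1)(\{\!\{v\}\!\}\bar\beta_2+\{\!\{w\}\!\}\bar\beta_3).$$ Let $\widehat{\mathcal R}=[\hat r_{+f}|\hat r_{+a}|\hat r_{+s}|\hat r_E|\hat r_D|\hat r_{-s}|\hat r_{-a}|\hat r_{-f}]$ with columns $$\hat r_E=\big(1,\{\!\{u\}\!\},\{\!\{v\}\!\},\{\!\{w\}\!\},\tfrac12\overline{\|\vec u\|^2},0,0,0\big)^T,\qquad \hat r_D=(0,0,0,0,\{\!\{B_1\}\!\},1,0,0)^T,$$ $$\hat r_{\pm a}=\Big(0,\,0,\,\pm\rho^{\ln}\sqrt{\{\!\{\rho\}\!\}}\,\bar\beta_3,\,\mp\rho^{\ln}\sqrt{\{\!\{\rho\}\!\}}\,\bar\beta_2,\,\mp\rho^{\ln}\sqrt{\{\!\{\rho\}\!\}}(\bar\beta_2\{\!\{w\}\!\}-\bar\beta_3\{\!\{v\}\!\}),\,0,\,-\rho^{\ln}\bar\beta_3,\,\rho^{\ln}\bar\beta_2\Big)^T,$$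 $$\hat r_{\pm f}=\begin{bmatrix}\hat\alpha_f\rho^{\ln}\\ \hat\alpha_f\rho^{\ln}(\{\!\{u\}\!\}\pm\hat c_f)\\ \rho^{\ln}(\hat\alpha_f\{\!\{v\}\!\}\mp\hat\alpha_s\hat c_s\bar\beta_2\sigma(\bar b_1))\\ \rho^{\ln}(\hat\alpha_f\{\!\{w\}\!\}\mp\hat\alpha_s\hat c_s\bar\beta_3\sigma(\bar b_1))\\ \hat\Psi_{\pm f}\\0\\ \hat\alpha_sa^\beta\bar\beta_2\sqrt{\rho^{\ln}}\\ \hat\alpha_sa^\beta\bar\beta_3\sqrt{\rho^{\ln}}\end{bmatrix},\qquad \hat r_{\pm s}=\begin{bmatrix}\hat\alpha_s\rho^{\ln}\\ \hat\alpha_s\rho^{\ln}(\{\!\{u\}\!\}\pm\hat c_s)\\ \rho^{\ln}(\hat\alpha_s\{\!\{v\}\!\}\pm\hat\alpha_f\hat c_f\bar\beta_2\sigma(\bar b_1))\\ \rho^{\ln}(\hat\alpha_s\{\!\{w\}\!\}\pm\hat\alpha_f\hat c_f\bar\beta_3\sigma(\bar b_1))\\ \hat\Psi_{\pm s}\\0\\ -\hat\alpha_fa^\beta\bar\beta_2\sqrt{\rho^{\ln}}\\ -\hat\alpha_fa^\beta\bar\beta_3\sqrt{\rho^{\ln}}\end{bmatrix},$$ and let $$\widehat{\mathcal Z}=\mathrm{diag}\Big(\tfrac1{2\gamma\rho^{\ln}},\ \tfrac1{4\{\!\{\beta\}\!\}(\rho^{\ln})^2},\ \tfrac1{2\gamma\rho^{\ln}},\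 \tfrac{\rho^{\ln}(\gamma-1)}\gamma,\ \tfrac1{2\{\!\{\beta\}\!\}},\ \tfrac1{2\gamma\rho^{\ln}},\ \tfrac1{4\{\!\{\beta\}\!\}(\rho^{\ln})^2},\ \tfrac1{2\gamma\rho^{\ln}}\Big).$$ Then $$\widehat{\mathcal H}=\widehat{\mathcal R}\,\widehat{\mathcal Z}\,\widehat{\mathcal R}^T .$$
   Context: A state is given by density $\rho>0$, velocity $\vec u=(u,v,w)$, pressure $p>0$, magnetic field $\vec B=(B_1,B_2,B_3)$; $\gamma>1$ is constant; $\beta=\frac\rho{2p}$. For two states $L,R$: $\{\!\{a\}\!\}=\frac12(a_L+a_R)$, and $a^{\ln}=\frac{a_L-a_R}{\ln a_L-\ln a_R}$ for positive $a$ (the common value if $a_L=a_R$), used for $\rho^{\ln},\beta^{\ln}$. Further $p^{\ln}=\frac{\rho^{\ln}}{2\beta^{\ln}}$, $$\overline{\|\vec u\|^2}=2\big(\{\!\{u\}\!\}^2+\{\!\{v\}\!\}^2+\{\!\{w\}\!\}^2\big)-\big(\{\!\{u^2\}\!\}+\{\!\{v^2\}\!\}+\{\!\{w^2\}\!\}\big),\quad \overline E=\frac{p^{\ln}}{\gamma-1}+\tfrac12\rho^{\ln}\overline{\|\vec u\|^2},\quad \tilde p=\frac{\{\!\{\rho\}\!\}}{2\{\!\{\beta\}\!\}},\quad \tau=\frac{\tilde p}{\{\!\{\rho\}\!\}}.$$ The quantities $\bar a,a^{\ln},a^\beta,\hat c_f,\hat c_s,\hat\alpha_f,\hat\alpha_s,\bar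 b_\perp$ are the nonnegative square roots of their squares (in $\hat c_{f,s}^2$ the sign $+$ is for $f$ and $-$ for $s$), and it is assumed that $\bar b_\perp>0$. Note that $a^{\ln}$ in $(a^{\ln})^2=\gamma p^{\ln}/\rho^{\ln}$ denotes this average sound speed. The discrete entropy Jacobian is $$\widehat{\mathcal H}=\begin{bmatrix} \rho^{\ln}&\rho^{\ln}\{\!\{u\}\!\}&\rho^{\ln}\{\!\{v\}\!\}&\rho^{\ln}\{\!\{w\}\!\}&\overline E&0&0&0\\ \rho^{\ln}\{\!\{u\}\!\}&\rho^{\ln}\{\!\{u\}\!\}^2+\tilde p&\rho^{\ln}\{\!\{u\}\!\}\{\!\{v\}\!\}&\rho^{\ln}\{\!\{u\}\!\}\{\!\{w\}\!\}&(\overline E+\tilde p)\{\!\{u\}\!\}&0&0&0\\ \rho^{\ln}\{\!\{v\}\!\}&\rho^{\ln}\{\!\{v\}\!\}\{\!\{u\}\!\}&\rho^{\ln}\{\!\{v\}\!\}^2+\tilde p&\rho^{\ln}\{\!\{v\}\!\}\{\!\{w\}\!\}&(\overline E+\tilde p)\{\!\{v\}\!\}&0&0&0\\ \rho^{\ln}\{\!\{w\}\!\}&\rho^{\ln}\{\!\{w\}\!\}\{\!\{u\}\!\}&\rho^{\ln}\{\!\{w\}\!\}\{\!\{v\}\!\}&\rho^{\ln}\{\!\{w\}\!\}^2+\tilde p&(\overline E+\tilde p)\{\!\{w\}\!\}&0&0&0\\ \overline E&(\overline E+\tilde p)\{\!\{u\}\!\}&(\overline E+\tilde p)\{\!\{v\}\!\}&(\overline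 E+\tilde p)\{\!\{w\}\!\}&\widehat{\mathcal H}_{5,5}&\tau\{\!\{B_1\}\!\}&\tau\{\!\{B_2\}\!\}&\tau\{\!\{B_3\}\!\}\\ 0&0&0&0&\tau\{\!\{B_1\}\!\}&\tau&0&0\\ 0&0&0&0&\tau\{\!\{B_2\}\!\}&0&\tau&0\\ 0&0&0&0&\tau\{\!\{B_3\}\!\}&0&0&\tau \end{bmatrix},$$ $$\widehat{\mathcal H}_{5,5}=\frac1{\rho^{\ln}}\Big(\frac{(p^{\ln})^2}{\gamma-1}+\overline E^2\Big)+\tilde p\big(\{\!\{u\}\!\}^2+\{\!\{v\}\!\}^2+\{\!\{w\}\!\}^2\big)+\tau\sum_{i=1}^3\{\!\{B_i\}\!\}^2.$$ *)

(* Defs.v *)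
From HB Require Import structures.
From mathcomp Require Import all_boot all_order all_algebra.
From mathcomp Require Import reals exp.

Set Implicit Arguments.
Unset Strict Implicit.
Unset Printing Implicit Defensive.

Import Order.TTheory GRing.Theory Num.Theory.
Local Open Scope ring_scope.

Record mhd_state (R : realType) := MhdState {
  rho : R;
  u : R;
  v : R;
  w : R;
  p : R;
  B1 : R;
  B2 : R;
  B3 : R;
  rho_gt0 : 0 < rho;
  p_gt0 : 0 < p
}.

Definition beta (R : realType) (s : mhd_state R) : R := rho s / (2 * p s).

(* The logarithmic mean; only meaningful for positive arguments. *)
Definition log_mean (R : realType) (a b : R) : R :=
  if a == b then a else (a - b) / (ln a - ln b).

Definition sigma (R : realType) (x : R) : R := if 0 <= x then 1 else -1.

Definition mx_of_rows (R : realType) (n : nat) (s : seq (seq R)) : 'M[R]_n :=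
  \matrix_(i, j) nth 0 (nth [::] s i) j.

Definition mx_of_cols (R : realType) (n : nat) (s : seq (seq R)) : 'M[R]_n :=
  \matrix_(i, j) nth 0 (nth [::] s j) i.

Section Averages.
Context {R : realType} (gamma : R) (sL sR : mhd_state R).

Definition avg (q : mhd_state R -> R) : R := (q sL + q sR) / 2.
Definition lnavg (q : mhd_state R -> R) : R := log_mean (q sL) (q sR).

Local Notation "{{ q }}" := (avg q) (at level 0, q at level 99).

Definition rho_ln : R := lnavg (@rho R).
Definition beta_ln : R := lnavg (@beta R).
Definition p_ln : R := rho_ln / (2 * beta_ln).

(* This is not {{u^2 + v^2 + w^2}}: it can be negative. *)
Definition usq_bar : R :=
  2 * ({{@u R}} ^+ 2 + {{@v R}} ^+ 2 + {{@w R}} ^+ 2)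
  - ({{fun s => u s ^+ 2}} + {{fun s => v s ^+ 2}} + {{fun s => w s ^+ 2}}).

Definition E_bar : R := p_ln / (gamma - 1) + 2^-1 * rho_ln * usq_bar.
Definition p_tilde : R := {{@rho R}} / (2 * {{@beta R}}).
Definition tau : R := p_tilde / {{@rho R}}.

Definition H55 : R :=
  rho_ln^-1 * (p_ln ^+ 2 / (gamma - 1) + E_bar ^+ 2)
  + p_tilde * ({{@u R}} ^+ 2 + {{@v R}} ^+ 2 + {{@w R}} ^+ 2)
  + tau * ({{@B1 R}} ^+ 2 + {{@B2 R}} ^+ 2 + {{@B3 R}} ^+ 2).

Definition entropy_jacobian : 'M[R]_8 :=
  let r := rho_ln in let E := E_bar in let pt := p_tilde in let t := tau in
  let U := {{@u R}} in let V := {{@v R}} in let W := {{@w R}} in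
  let b1 := {{@B1 R}} in let b2 := {{@B2 R}} in let b3 := {{@B3 R}} in
  mx_of_rows 8
  [:: [:: r;     r * U;          r * V;          r * W;          E;            0;      0;      0];
      [:: r * U; r * U ^+ 2 + pt; r * U * V;      r * U * W;      (E + pt) * U; 0;      0;      0];
      [:: r * V; r * V * U;      r * V ^+ 2 + pt; r * V * W;      (E + pt) * V; 0;      0;      0];
      [:: r * W; r * W * U;      r * W * V;      r * W ^+ 2 + pt; (E + pt) * W; 0;      0;      0];
      [:: E;     (E + pt) * U;   (E + pt) * V;   (E + pt) * W;   H55;          t * b1; t * b2; t * b3];
      [:: 0;     0;              0;              0;              t * b1;       t;      0;      0];
      [:: 0;     0;              0;              0;              t * b2;       0;      t;      0];
      [:: 0;     0;              0;              0;              t * b3;       0;      0;      t]].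

Definition a_bar : R := Num.sqrt (gamma * (p_tilde / rho_ln)).
(* An average sound speed, not a logarithmic mean of sound speeds. *)
Definition a_ln : R := Num.sqrt (gamma * (p_ln / rho_ln)).
Definition a_beta : R := Num.sqrt (gamma * (2 * {{@beta R}})^-1).

Definition b1_bar : R := {{@B1 R}} / Num.sqrt rho_ln.
Definition b2_bar : R := {{@B2 R}} / Num.sqrt rho_ln.
Definition b3_bar : R := {{@B3 R}} / Num.sqrt rho_ln.
Definition bsq_bar : R := b1_bar ^+ 2 + b2_bar ^+ 2 + b3_bar ^+ 2.
Definition b_perp : R := Num.sqrt (b2_bar ^+ 2 + b3_bar ^+ 2).
Definition beta2_bar : R := b2_bar / b_perp.
Definition beta3_bar : R := b3_bar / b_perp.

Definition disc : R :=
  (a_bar ^+ 2 + bsq_bar) ^+ 2 - 4 * a_bar ^+ 2 * b1_bar ^+ 2.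
Definition c_f : R :=
  Num.sqrt (2^-1 * ((a_bar ^+ 2 + bsq_bar) + Num.sqrt disc)).
Definition c_s : R :=
  Num.sqrt (2^-1 * ((a_bar ^+ 2 + bsq_bar) - Num.sqrt disc)).

Definition alpha_f : R :=
  Num.sqrt ((a_bar ^+ 2 - c_s ^+ 2) / (c_f ^+ 2 - c_s ^+ 2)).
Definition alpha_s : R :=
  Num.sqrt ((c_f ^+ 2 - a_bar ^+ 2) / (c_f ^+ 2 - c_s ^+ 2)).

(* In what follows e = 1 selects the upper signs and e = -1 the lower ones. *)

Definition Psi_s (e : R) : R :=
  alpha_s * rho_ln * usq_bar / 2 - a_beta * alpha_f * rho_ln * b_perp
  + alpha_s * rho_ln * a_ln ^+ 2 / (gamma - 1)
  + e * (alpha_s * c_s * rho_ln * {{@u R}})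
  + e * (alpha_f * c_f * rho_ln * sigma b1_bar
         * ({{@v R}} * beta2_bar + {{@w R}} * beta3_bar)).

Definition Psi_f (e : R) : R :=
  alpha_f * rho_ln * usq_bar / 2 + a_beta * alpha_s * rho_ln * b_perp
  + alpha_f * rho_ln * a_ln ^+ 2 / (gamma - 1)
  + e * (alpha_f * c_f * rho_ln * {{@u R}})
  - e * (alpha_s * c_s * rho_ln * sigma b1_bar
         * ({{@v R}} * beta2_bar + {{@w R}} * beta3_bar)).

Definition r_E : seq R :=
  [:: 1; {{@u R}}; {{@v R}}; {{@w R}}; 2^-1 * usq_bar; 0; 0; 0].

Definition r_D : seq R := [:: 0; 0; 0; 0; {{@B1 R}}; 1; 0; 0].

Definition r_a (e : R) : seq R :=
  let sq := Num.sqrt {{@rho R}} in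
  [:: 0;
      0;
      e * (rho_ln * sq * beta3_bar);
      - e * (rho_ln * sq * beta2_bar);
      - e * (rho_ln * sq * (beta2_bar * {{@w R}} - beta3_bar * {{@v R}}));
      0;
      - rho_ln * beta3_bar;
      rho_ln * beta2_bar].

Definition r_f (e : R) : seq R :=
  [:: alpha_f * rho_ln;
      alpha_f * rho_ln * ({{@u R}} + e * c_f);
      rho_ln * (alpha_f * {{@v R}} - e * (alpha_s * c_s * beta2_bar * sigma b1_bar));
      rho_ln * (alpha_f * {{@w R}} - e * (alpha_s * c_s * beta3_bar * sigma b1_bar));
      Psi_f e;
      0;
      alpha_s * a_beta * beta2_bar * Num.sqrt rho_ln;
      alpha_s * a_beta * beta3_bar * Num.sqrt rho_ln].

Definition r_s (e : R) : seq R :=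
  [:: alpha_s * rho_ln;
      alpha_s * rho_ln * ({{@u R}} + e * c_s);
      rho_ln * (alpha_s * {{@v R}} + e * (alpha_f * c_f * beta2_bar * sigma b1_bar));
      rho_ln * (alpha_s * {{@w R}} + e * (alpha_f * c_f * beta3_bar * sigma b1_bar));
      Psi_s e;
      0;
      - alpha_f * a_beta * beta2_bar * Num.sqrt rho_ln;
      - alpha_f * a_beta * beta3_bar * Num.sqrt rho_ln].

Definition R_hat : 'M[R]_8 :=
  mx_of_cols 8
  [:: r_f 1; r_a 1; r_s 1; r_E; r_D; r_s (-1); r_a (-1); r_f (-1)].

Definition Z_hat : 'M[R]_8 :=
  let zfs := (2 * gamma * rho_ln)^-1 in
  let za := (4 * {{@beta R}} * rho_ln ^+ 2)^-1 in
  diag_mx (\row_j nth 0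
    [:: zfs; za; zfs; rho_ln * (gamma - 1) / gamma; (2 * {{@beta R}})^-1;
        zfs; za; zfs] j).

End Averages.

(* Main.v *)
Require Import Defs.
From HB Require Import structures.
From mathcomp Require Import all_boot all_order all_algebra.
From mathcomp Require Import reals exp.
From mathcomp Require Import ring lra.

(** Each side is a sum of dyads: the entry at [(i, j)] of
    [R_hat *m Z_hat *m R_hat^T] is the sum over the eight columns [r] of
    [z * r_i * r_j].  The proof moves every column to one fixed frame that does
    not see the wave structure: [r_E], the unit vector of the energy component,
    the three vectors [kick_u], [kick_v], [kick_w] (a unit change of one
    velocity component and the kinetic energy that goes with it), and [r_D],
    [field_2], [field_3] (a unit change of one magnetic component and its
    magnetic energy).

    In this frame all the wave structure consists of orthogonal changes of
    basis, and a sum of dyads does not see a rotation.  Three of them occur.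
    - The part of [r_f e] and [r_s e] even in the sign [e] is the rotation by
      [(alpha_f, alpha_s)] of a thermodynamic vector and of the transverse
      magnetic direction; [alpha_f ^+ 2 + alpha_s ^+ 2 = 1].
    - The odd part is a rotation of the longitudinal and the transverse kick by
      [(alpha_f * c_f, alpha_s * c_s)], scaled because
      [(alpha_f * c_f) ^+ 2 + (alpha_s * c_s) ^+ 2 = a_bar ^+ 2].
    - The transverse directions seen by the magnetosonic columns and the ones
      seen by the Alfven columns [r_a e] are the rotation by
      [(beta2_bar, beta3_bar)] of the second and third coordinate directions.
    Summing over [e = 1] and [e = -1] removes the even-odd cross terms.  Each
    scale factor is then just the one that leaves the weight [p_tilde] on the
    kicks and [tau] on the magnetic vectors, and the resulting diagonal
    decomposition is the entropy Jacobian entry by entry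
    ([entropy_jacobian_dyads], [column_dyads]).

    The square roots defining the averages are true roots because the
    logarithmic means are positive, and because the discriminant equals
    [(a_bar ^+ 2 - bsq_bar) ^+ 2 + 4 * a_bar ^+ 2 * b_perp ^+ 2], which places
    [a_bar ^+ 2] between [c_s ^+ 2] and [c_f ^+ 2]; it is positive as
    [b_perp > 0], so that the two speeds are distinct. *)

Set Implicit Arguments.
Unset Strict Implicit.
Unset Printing Implicit Defensive.

Import Order.TTheory GRing.Theory Num.Theory.
Local Open Scope ring_scope.

Lemma log_mean_gt0 (R : realType) (a b : R) :
  0 < a -> 0 < b -> 0 < log_mean a b.
Proof.
move=> a0 b0; rewrite /log_mean; case: eqVneq => [//|ab].
have [lt_ab|lt_ba|eq_ab] := ltgtP a b; last by rewrite eq_ab eqxx in ab.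
- have ln_ab : ln a < ln b by rewrite ltr_ln ?posrE.
  by rewrite -mulrNN -invrN !opprB divr_gt0 // subr_gt0.
- have ln_ba : ln b < ln a by rewrite ltr_ln ?posrE.
  by rewrite divr_gt0 // subr_gt0.
Qed.

Lemma sigma_sqr (R : realType) (x : R) : sigma x ^+ 2 = 1.
Proof. by rewrite /sigma; case: ifP => _; rewrite ?sqrrN expr1n. Qed.

(** * Sums of dyads and rotations *)

Lemma dyads_of_cols (R : realType) n (cols : seq (seq R)) (d : seq R)
    (i j : 'I_n) :
  let M := mx_of_cols n cols in
  (M *m diag_mx (\row_k nth 0 d k) *m M^T) i j =
  \sum_(k < n) nth 0 d k *
    (nth 0 (nth [::] cols k) i * nth 0 (nth [::] cols k) j).
Proof.
move=> M; rewrite mxE; apply: eq_bigr => k _.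
by rewrite mul_mx_diag !mxE -mulrA mulrCA.
Qed.

(** Polarized invariance of [x ^+ 2 + y ^+ 2] under the rotation by [(a, b)]. *)
Lemma rotation_dyads (R : comPzRingType) (a b x y x' y' : R) :
  (a * x - b * y) * (a * x' - b * y') + (b * x + a * y) * (b * x' + a * y') =
  (a ^+ 2 + b ^+ 2) * (x * x' + y * y').
Proof. by ring. Qed.

(** Opposite waves share their even part and have opposite odd parts, so the
    cross terms cancel between them. *)
Lemma opposite_dyads (R : comPzRingType) (x y x' y' : R) :
  (x + 1 * y) * (x' + 1 * y') + (x + -1 * y) * (x' + -1 * y') =
  2 * (x * x' + y * y').
Proof. by ring. Qed.

Section MHD.
Context (R : realType) (gamma : R) (sL sR : mhd_state R).
Hypotheses (gamma_gt1 : 1 < gamma) (perp_gt0 : 0 < b_perp sL sR).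

(** * Positivity of the averages *)

Let gamma_gt0 : 0 < gamma. Proof. exact: lt_trans gamma_gt1. Qed.

Lemma beta_gt0 (s : mhd_state R) : 0 < beta s.
Proof. by rewrite divr_gt0 ?rho_gt0 // mulr_gt0 ?p_gt0. Qed.

Lemma rho_ln_gt0 : 0 < rho_ln sL sR.
Proof. by apply: log_mean_gt0; apply: rho_gt0. Qed.

Lemma p_ln_gt0 : 0 < p_ln sL sR.
Proof.
by rewrite divr_gt0 ?rho_ln_gt0 // mulr_gt0 ?log_mean_gt0 ?beta_gt0.
Qed.

Lemma avg_gt0 (q : mhd_state R -> R) :
  (forall s, 0 < q s) -> 0 < avg sL sR q.
Proof. by move=> q0; rewrite divr_gt0 ?addr_gt0. Qed.

Let avg_rho_gt0 : 0 < avg sL sR (@rho R).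
Proof. exact/avg_gt0/rho_gt0. Qed.

Let avg_beta_gt0 : 0 < avg sL sR (@beta R).
Proof. exact/avg_gt0/beta_gt0. Qed.

Lemma p_tilde_gt0 : 0 < p_tilde sL sR.
Proof. exact: divr_gt0 avg_rho_gt0 (mulr_gt0 (ltr0Sn R 1) avg_beta_gt0). Qed.

Lemma tauE : tau sL sR = (2 * avg sL sR (@beta R))^-1.
Proof. by rewrite /tau /p_tilde; field; rewrite !gt_eqF. Qed.

Lemma p_tildeE : p_tilde sL sR = avg sL sR (@rho R) * tau sL sR.
Proof. by rewrite tauE. Qed.

Lemma a_bar_sqr :
  a_bar gamma sL sR ^+ 2 = gamma * (p_tilde sL sR / rho_ln sL sR).
Proof.
rewrite sqr_sqrtr // ltW //; apply: mulr_gt0 => //.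
exact: divr_gt0 p_tilde_gt0 rho_ln_gt0.
Qed.

Lemma a_bar_sqr_gt0 : 0 < a_bar gamma sL sR ^+ 2.
Proof.
rewrite a_bar_sqr; apply: mulr_gt0 => //.
exact: divr_gt0 p_tilde_gt0 rho_ln_gt0.
Qed.

Lemma a_ln_sqr : a_ln gamma sL sR ^+ 2 = gamma * (p_ln sL sR / rho_ln sL sR).
Proof.
rewrite sqr_sqrtr // ltW //; apply: mulr_gt0 => //.
exact: divr_gt0 p_ln_gt0 rho_ln_gt0.
Qed.

Lemma a_beta_sqr : a_beta gamma sL sR ^+ 2 = gamma * tau sL sR.
Proof.
rewrite tauE sqr_sqrtr // ltW // mulr_gt0 // invr_gt0.
exact: mulr_gt0.
Qed.

Lemma b_perp_sqr :
  b_perp sL sR ^+ 2 = b2_bar sL sR ^+ 2 + b3_bar sL sR ^+ 2.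
Proof. by rewrite sqr_sqrtr // addr_ge0 ?sqr_ge0. Qed.

Lemma beta_bar_unit : beta2_bar sL sR ^+ 2 + beta3_bar sL sR ^+ 2 = 1.
Proof.
have perp_neq0 : b_perp sL sR != 0 by rewrite gt_eqF.
transitivity ((b2_bar sL sR ^+ 2 + b3_bar sL sR ^+ 2) / b_perp sL sR ^+ 2).
  by rewrite /beta2_bar /beta3_bar; field.
by rewrite -b_perp_sqr divff // expf_neq0.
Qed.

(** Since [(beta2_bar, beta3_bar)] is the direction of the transverse field,
    [b_perp] is the component of that field along it. *)
Lemma b_perp_rho_ln :
  rho_ln sL sR * b_perp sL sR = Num.sqrt (rho_ln sL sR) *
    (beta2_bar sL sR * avg sL sR (@B2 R) + beta3_bar sL sR * avg sL sR (@B3 R)).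
Proof.
have perp_neq0 : b_perp sL sR != 0 by rewrite gt_eqF.
have sqrt_neq0 : Num.sqrt (rho_ln sL sR) != 0.
  by rewrite gt_eqF // sqrtr_gt0 rho_ln_gt0.
have sqrt_sqr : Num.sqrt (rho_ln sL sR) ^+ 2 = rho_ln sL sR.
  by rewrite sqr_sqrtr // ltW // rho_ln_gt0.
have -> : avg sL sR (@B2 R) = b2_bar sL sR * Num.sqrt (rho_ln sL sR).
  by rewrite divfK.
have -> : avg sL sR (@B3 R) = b3_bar sL sR * Num.sqrt (rho_ln sL sR).
  by rewrite divfK.
apply: (mulIf perp_neq0); rewrite -mulrA -expr2 b_perp_sqr -{1}sqrt_sqr.
by rewrite /beta2_bar /beta3_bar; field.
Qed.

(** * Magnetosonic speeds and weights *)

Lemma discE : disc gamma sL sR =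
  (a_bar gamma sL sR ^+ 2 - bsq_bar sL sR) ^+ 2
  + 4 * a_bar gamma sL sR ^+ 2 * b_perp sL sR ^+ 2.
Proof. by rewrite /disc b_perp_sqr /bsq_bar; ring. Qed.

Lemma disc_gt0 : 0 < disc gamma sL sR.
Proof.
rewrite discE ltr_wpDl ?sqr_ge0 //.
by rewrite mulr_gt0 ?exprn_gt0 // mulr_gt0 // a_bar_sqr_gt0.
Qed.

Lemma bsq_bar_ge0 : 0 <= bsq_bar sL sR.
Proof. by rewrite !addr_ge0 ?sqr_ge0. Qed.

Lemma c_f_sqr : c_f gamma sL sR ^+ 2 =
  2^-1 * (a_bar gamma sL sR ^+ 2 + bsq_bar sL sR + Num.sqrt (disc gamma sL sR)).
Proof.
by rewrite sqr_sqrtr // mulr_ge0 ?invr_ge0 // !addr_ge0 ?sqrtr_ge0 ?sqr_ge0.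
Qed.

Lemma c_s_sqr : c_s gamma sL sR ^+ 2 =
  2^-1 * (a_bar gamma sL sR ^+ 2 + bsq_bar sL sR - Num.sqrt (disc gamma sL sR)).
Proof.
have sum_ge0 : 0 <= a_bar gamma sL sR ^+ 2 + bsq_bar sL sR.
  by rewrite addr_ge0 ?sqr_ge0 // bsq_bar_ge0.
rewrite sqr_sqrtr // mulr_ge0 ?invr_ge0 // subr_ge0.
rewrite -(ger0_norm sum_ge0) -sqrtr_sqr ler_wsqrtr // gerBl.
by rewrite mulr_ge0 ?sqr_ge0 // mulr_ge0 ?sqr_ge0.
Qed.

Lemma c_s_lt_c_f : c_s gamma sL sR ^+ 2 < c_f gamma sL sR ^+ 2.
Proof.
have : 0 < Num.sqrt (disc gamma sL sR) by rewrite sqrtr_gt0 disc_gt0.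
by rewrite c_s_sqr c_f_sqr; lra.
Qed.

Lemma a_bar_between :
  c_s gamma sL sR ^+ 2 <= a_bar gamma sL sR ^+ 2 <= c_f gamma sL sR ^+ 2.
Proof.
have : `|a_bar gamma sL sR ^+ 2 - bsq_bar sL sR| <= Num.sqrt (disc gamma sL sR).
  rewrite -sqrtr_sqr ler_wsqrtr // discE lerDl.
  by rewrite mulr_ge0 ?sqr_ge0 // mulr_ge0 ?sqr_ge0.
by rewrite ler_norml c_s_sqr c_f_sqr => /andP[lo hi]; apply/andP; split; lra.
Qed.

Lemma alpha_f_sqr : alpha_f gamma sL sR ^+ 2 =
  (a_bar gamma sL sR ^+ 2 - c_s gamma sL sR ^+ 2) /
  (c_f gamma sL sR ^+ 2 - c_s gamma sL sR ^+ 2).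
Proof.
have /andP[lo _] := a_bar_between; have lt_sf := c_s_lt_c_f.
by rewrite sqr_sqrtr // divr_ge0 // subr_ge0 // ltW.
Qed.

Lemma alpha_s_sqr : alpha_s gamma sL sR ^+ 2 =
  (c_f gamma sL sR ^+ 2 - a_bar gamma sL sR ^+ 2) /
  (c_f gamma sL sR ^+ 2 - c_s gamma sL sR ^+ 2).
Proof.
have /andP[_ hi] := a_bar_between; have lt_sf := c_s_lt_c_f.
by rewrite sqr_sqrtr // divr_ge0 // subr_ge0 // ltW.
Qed.

(** [alpha_f ^+ 2] and [alpha_s ^+ 2] are the barycentric coordinates of
    [a_bar ^+ 2] between [c_f ^+ 2] and [c_s ^+ 2]; this lemma and
    [alpha_c_norm] are the two equations that say so. *)
Lemma alpha_unit : alpha_f gamma sL sR ^+ 2 + alpha_s gamma sL sR ^+ 2 = 1.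
Proof.
rewrite alpha_f_sqr alpha_s_sqr; field.
by rewrite subr_eq0 gt_eqF // c_s_lt_c_f.
Qed.

Lemma alpha_c_norm :
  (alpha_f gamma sL sR * c_f gamma sL sR) ^+ 2
  + (alpha_s gamma sL sR * c_s gamma sL sR) ^+ 2 = a_bar gamma sL sR ^+ 2.
Proof.
rewrite !exprMn alpha_f_sqr alpha_s_sqr; field.
by rewrite subr_eq0 gt_eqF // c_s_lt_c_f.
Qed.

(** * The columns in a frame without wave structure *)

Local Notation U := (avg sL sR (@u R)).
Local Notation V := (avg sL sR (@v R)).
Local Notation W := (avg sL sR (@w R)).
Local Notation r := (rho_ln sL sR).
Local Notation af := (alpha_f gamma sL sR).
Local Notation as_ := (alpha_s gamma sL sR).
Local Notation cf := (c_f gamma sL sR).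
Local Notation cs := (c_s gamma sL sR).
Local Notation beta2 := (beta2_bar sL sR).
Local Notation beta3 := (beta3_bar sL sR).
Local Notation sgn := (sigma (b1_bar sL sR)).

(** [gamma / (gamma - 1) * p_ln] is the enthalpy that an acoustic perturbation
    carries on top of advected mass. *)
Definition thermo (i : nat) : R :=
  r * nth 0 (r_E sL sR) i
  + gamma * p_ln sL sR / (gamma - 1) * nth 0 [:: 0; 0; 0; 0; 1] i.

Definition kick_u : seq R := [:: 0; 1; 0; 0; U; 0; 0; 0].
Definition kick_v : seq R := [:: 0; 0; 1; 0; V; 0; 0; 0].
Definition kick_w : seq R := [:: 0; 0; 0; 1; W; 0; 0; 0].
Definition field_2 : seq R := [:: 0; 0; 0; 0; avg sL sR (@B2 R); 0; 1; 0].
Definition field_3 : seq R := [:: 0; 0; 0; 0; avg sL sR (@B3 R); 0; 0; 1].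

(** The transverse frames, parallel and normal to the transverse field. *)
Definition kick_par (i : nat) : R :=
  beta2 * nth 0 kick_v i + beta3 * nth 0 kick_w i.
Definition kick_nor (i : nat) : R :=
  beta3 * nth 0 kick_v i - beta2 * nth 0 kick_w i.
Definition field_par (i : nat) : R :=
  beta2 * nth 0 field_2 i + beta3 * nth 0 field_3 i.
Definition field_nor (i : nat) : R :=
  beta3 * nth 0 field_2 i - beta2 * nth 0 field_3 i.

Lemma kick_rotation i j :
  kick_par i * kick_par j + kick_nor i * kick_nor j =
  nth 0 kick_v i * nth 0 kick_v j + nth 0 kick_w i * nth 0 kick_w j.
Proof.
rewrite addrC (rotation_dyads beta3 beta2) [beta3 ^+ 2 + _]addrC.
by rewrite beta_bar_unit mul1r.
Qed.

Lemma field_rotation i j :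
  field_par i * field_par j + field_nor i * field_nor j =
  nth 0 field_2 i * nth 0 field_2 j + nth 0 field_3 i * nth 0 field_3 j.
Proof.
rewrite addrC (rotation_dyads beta3 beta2) [beta3 ^+ 2 + _]addrC.
by rewrite beta_bar_unit mul1r.
Qed.

Let r_neq0 : r != 0. Proof. by rewrite gt_eqF ?rho_ln_gt0. Qed.
Let gamma_neq0 : gamma != 0. Proof. by rewrite gt_eqF. Qed.
Let gammaB1_neq0 : gamma - 1 != 0. Proof. by rewrite subr_eq0 gt_eqF. Qed.

(** [field_par] may carry the energy term of [Psi_f] in [b_perp], and of
    [Psi_s] below, because of [b_perp_rho_ln]. *)
Lemma fast_column e i :
  nth 0 (r_f gamma sL sR e) i =
  (af * thermo i
   + as_ * (a_beta gamma sL sR * Num.sqrt r * field_par i))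
  + e * (af * cf * (r * nth 0 kick_u i) - as_ * cs * (r * sgn * kick_par i)).
Proof.
rewrite /thermo /field_par /kick_par.
do 4 (case: i => [|i]; first by rewrite /=; field; rewrite gammaB1_neq0).
case: i => [|i].
  rewrite /= /Psi_f a_ln_sqr.
  have -> : a_beta gamma sL sR * as_ * r * b_perp sL sR =
    a_beta gamma sL sR * as_ * (r * b_perp sL sR) by ring.
  by rewrite b_perp_rho_ln; field; rewrite r_neq0 gammaB1_neq0.
do 3 (case: i => [|i]; first by rewrite /=; field; rewrite gammaB1_neq0).
by rewrite /= !nth_nil; ring.
Qed.

Lemma slow_column e i :
  nth 0 (r_s gamma sL sR e) i =
  (as_ * thermo i
   - af * (a_beta gamma sL sR * Num.sqrt r * field_par i))
  + e * (as_ * cs * (r * nth 0 kick_u i) + af * cf * (r * sgn * kick_par i)).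
Proof.
rewrite /thermo /field_par /kick_par.
do 4 (case: i => [|i]; first by rewrite /=; field; rewrite gammaB1_neq0).
case: i => [|i].
  rewrite /= /Psi_s a_ln_sqr.
  have -> : a_beta gamma sL sR * af * r * b_perp sL sR =
    a_beta gamma sL sR * af * (r * b_perp sL sR) by ring.
  by rewrite b_perp_rho_ln; field; rewrite r_neq0 gammaB1_neq0.
do 3 (case: i => [|i]; first by rewrite /=; field; rewrite gammaB1_neq0).
by rewrite /= !nth_nil; ring.
Qed.

(** The energy entry of [field_nor] vanishes, the averaged field having no
    component normal to its own transverse direction. *)
Lemma alfven_column e i :
  nth 0 (r_a sL sR e) i =
  - r * field_nor i
  + e * (r * Num.sqrt (avg sL sR (@rho R)) * kick_nor i).
Proof.
have parallel : beta3 * avg sL sR (@B2 R) = beta2 * avg sL sR (@B3 R).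
  by rewrite /beta2_bar /beta3_bar /b2_bar /b3_bar; ring.
rewrite /field_nor /kick_nor.
do 4 (case: i => [|i]; first by rewrite /=; ring).
case: i => [|i]; first by rewrite /= parallel; ring.
do 3 (case: i => [|i]; first by rewrite /=; ring).
by rewrite /= !nth_nil; ring.
Qed.

(** * The dyads of the entropy Jacobian *)

Definition kick_dyads (i j : nat) : R :=
  nth 0 kick_u i * nth 0 kick_u j
  + (nth 0 kick_v i * nth 0 kick_v j + nth 0 kick_w i * nth 0 kick_w j).

Definition transverse_field_dyads (i j : nat) : R :=
  nth 0 field_2 i * nth 0 field_2 j + nth 0 field_3 i * nth 0 field_3 j.

(** The first two weights are fixed by the mass entry,
    [(gamma * r)^-1 * r ^+ 2 + r * (gamma - 1) / gamma = r], and by the internal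
    energy, [gamma / (gamma - 1) ^+ 2 = (gamma - 1)^-1 + (gamma - 1) ^- 2]. *)
Lemma entropy_jacobian_dyads (i j : 'I_8) :
  entropy_jacobian gamma sL sR i j =
  (gamma * r)^-1 * (thermo i * thermo j)
  + r * (gamma - 1) / gamma * (nth 0 (r_E sL sR) i * nth 0 (r_E sL sR) j)
  + p_tilde sL sR * kick_dyads i j
  + tau sL sR * (nth 0 (r_D sL sR) i * nth 0 (r_D sL sR) j
                 + transverse_field_dyads i j).
Proof.
rewrite mxE /kick_dyads /transverse_field_dyads /thermo /H55 /E_bar.
case: i j => [i lti] [j ltj] /=.
do 8 (case: i lti => [|i] lti;
  first by do 8 (case: j ltj => [|j] ltj;
    first by rewrite /=; field; rewrite ?gamma_neq0 ?r_neq0 ?gammaB1_neq0)).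
by [].
Qed.

(** The factors [gamma * r] come out the same for both directions:
    [a_beta ^+ 2 * r = gamma * r * tau] for the magnetic part and
    [a_bar ^+ 2 * r ^+ 2 = gamma * r * p_tilde] for the kicks; their common
    value cancels against the weight [(2 * gamma * r)^-1] of these columns. *)
Lemma magnetosonic_dyads (i j : nat) :
  (nth 0 (r_f gamma sL sR 1) i * nth 0 (r_f gamma sL sR 1) j
   + nth 0 (r_f gamma sL sR (-1)) i * nth 0 (r_f gamma sL sR (-1)) j)
  + (nth 0 (r_s gamma sL sR 1) i * nth 0 (r_s gamma sL sR 1) j
   + nth 0 (r_s gamma sL sR (-1)) i * nth 0 (r_s gamma sL sR (-1)) j) =
  2 * (thermo i * thermo j
       + gamma * r * (tau sL sR * (field_par i * field_par j)
           + p_tilde sL sR * (nth 0 kick_u i * nth 0 kick_u j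
                              + kick_par i * kick_par j))).
Proof.
rewrite !fast_column !slow_column !opposite_dyads -mulrDr; congr (2 * _).
(* Pair the slow columns with the fast ones, even parts with even parts. *)
rewrite addrACA [X in X + _]addrC !rotation_dyads addrC.
rewrite [as_ ^+ 2 + _]addrC alpha_unit alpha_c_norm a_bar_sqr mul1r.
have sqrt_sqr : Num.sqrt r ^+ 2 = r by rewrite sqr_sqrtr // ltW // rho_ln_gt0.
transitivity (thermo i * thermo j
  + (a_beta gamma sL sR ^+ 2 * Num.sqrt r ^+ 2 * (field_par i * field_par j)
     + gamma * (p_tilde sL sR / r) * r ^+ 2
       * (nth 0 kick_u i * nth 0 kick_u j
          + sgn ^+ 2 * (kick_par i * kick_par j)))); first by ring.
by rewrite a_beta_sqr sqrt_sqr sigma_sqr; field.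
Qed.

(** These columns have weight [tau / (2 * r ^+ 2)], and [p_tilde] is [tau] times
    the averaged density: they contribute exactly what the magnetosonic columns
    lack in the normal direction. *)
Lemma alfven_dyads (i j : nat) :
  nth 0 (r_a sL sR 1) i * nth 0 (r_a sL sR 1) j
  + nth 0 (r_a sL sR (-1)) i * nth 0 (r_a sL sR (-1)) j =
  2 * r ^+ 2 * (field_nor i * field_nor j
                + avg sL sR (@rho R) * (kick_nor i * kick_nor j)).
Proof.
rewrite !alfven_column opposite_dyads.
rewrite -{3}[avg sL sR (@rho R)]sqr_sqrtr; last exact: ltW.
by ring.
Qed.

Lemma column_dyads (i j : 'I_8) :
  (R_hat gamma sL sR *m Z_hat gamma sL sR *m (R_hat gamma sL sR)^T) i j =
  (gamma * r)^-1 * (thermo i * thermo j)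
  + r * (gamma - 1) / gamma * (nth 0 (r_E sL sR) i * nth 0 (r_E sL sR) j)
  + p_tilde sL sR * kick_dyads i j
  + tau sL sR * (nth 0 (r_D sL sR) i * nth 0 (r_D sL sR) j
                 + transverse_field_dyads i j).
Proof.
rewrite dyads_of_cols /kick_dyads /transverse_field_dyads.
rewrite -kick_rotation -field_rotation !big_ord_recl big_ord0 /=.
have tau4 : (4 * avg sL sR (@beta R) * r ^+ 2)^-1 = tau sL sR / (2 * r ^+ 2).
  by rewrite tauE; field; rewrite r_neq0 gt_eqF.
rewrite tau4 -tauE.
symmetry; transitivity ((2 * gamma * r)^-1 * (2 * (thermo i * thermo j
       + gamma * r * (tau sL sR * (field_par i * field_par j)
           + p_tilde sL sR * (nth 0 kick_u i * nth 0 kick_u j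
                              + kick_par i * kick_par j))))
  + tau sL sR / (2 * r ^+ 2) * (2 * r ^+ 2 * (field_nor i * field_nor j
                + avg sL sR (@rho R) * (kick_nor i * kick_nor j)))
  + r * (gamma - 1) / gamma * (nth 0 (r_E sL sR) i * nth 0 (r_E sL sR) j)
  + tau sL sR * (nth 0 (r_D sL sR) i * nth 0 (r_D sL sR) j)).
  by rewrite p_tildeE; field; rewrite r_neq0 gamma_neq0.
rewrite -magnetosonic_dyads -alfven_dyads.
by ring.
Qed.

End MHD.

Theorem theorem4 (R : realType) (gamma : R) (sL sR : mhd_state R)
    (hgamma : 1 < gamma) (hperp : 0 < b_perp sL sR) :
  entropy_jacobian gamma sL sR =
    R_hat gamma sL sR *m Z_hat gamma sL sR *m (R_hat gamma sL sR)^T.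
Proof.
apply/matrixP => i j.
by rewrite (entropy_jacobian_dyads _ _ hgamma) (column_dyads hgamma hperp).
Qed.
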